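(* The class of line graphs has the weighted strong Erdős–Hajnal property: there exists $\delta>0$ such that for every line graph $G$ and every probability measure $\mu$ on $V(G)$ with $\mu(\{v\})\leq 1-2\delta$ for all $v\in V(G)$, there exists a homogeneous pair $(P,Q)$ in $G$ with $\mu(P),\mu(Q)\geq\delta$.
   Context: A multigraph has a multiset of edges, each an unordered pair of distinct vertices. The line graph $L(H)$ of a multigraph $H$ has vertex set $E(H)$, two edges adjacent iff they share an endpoint. A line graph is a graph isomorphic to $L(H)$ for some multigraph $H$. For disjoint vertex sets $P,Q$, $(P,Q)$ is a homogeneous pair if either all edges between $P$ and $Q$ are present or none are. *)

(* Defs.v *)
From HB Require Import structures.
From mathcomp Require Import all_boot all_order all_algebra.
From mathcomp Require Import reals.

Set Implicit Arguments.
Unset Strict Implicit.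
Unset Printing Implicit Defensive.

Import Order.TTheory GRing.Theory Num.Theory.
Local Open Scope ring_scope.

(* Finite simple graphs. *)
Record sgraph := SGraph {
  vertex :> finType;
  adj : rel vertex;
  adj_sym : symmetric adj;
  adj_irrefl : irreflexive adj }.

(* The multiset of edges is encoded by a type of edge labels: two distinct
   labels with the same set of ends are parallel edges. *)
Record multigraph := MultiGraph {
  mvertex : finType;
  medge : finType;
  ends : medge -> {set mvertex};
  card_ends : forall e, #|ends e| = 2%N }.

Definition line_adj (H : multigraph) : rel (medge H) :=
  fun e f => (e != f) && [exists x, (x \in ends e) && (x \in ends f)].

Lemma line_adj_sym (H : multigraph) : symmetric (@line_adj H).
Proof.
by move=> e f; rewrite /line_adj eq_sym; congr andb; apply: eq_existsb => x;
  rewrite andbC.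
Qed.

Lemma line_adj_irrefl (H : multigraph) : irreflexive (@line_adj H).
Proof. by move=> e; rewrite /line_adj eqxx. Qed.

Definition line_graph_of (H : multigraph) : sgraph :=
  SGraph (@line_adj_sym H) (@line_adj_irrefl H).

Definition isomorphic (G1 G2 : sgraph) : Prop :=
  exists2 f : G1 -> G2, bijective f & forall x y, adj (f x) (f y) = adj x y.

Definition is_line_graph (G : sgraph) : Prop :=
  exists H : multigraph, isomorphic G (line_graph_of H).

Definition homogeneous_pair (G : sgraph) (P Q : {set G}) : Prop :=
  [disjoint P & Q] /\
  ((forall x y, x \in P -> y \in Q -> adj x y) \/
   (forall x y, x \in P -> y \in Q -> ~~ adj x y)).

(* On a finite set all subsets are measurable, and countable additivity is
   finite additivity. *)
Definition probability_measure (R : realType) (T : finType)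
    (mu : {set T} -> R) : Prop :=
  [/\ forall A, 0 <= mu A,
      mu [set: T] = 1
    & forall A B : {set T}, [disjoint A & B] -> mu (A :|: B) = mu A + mu B].

(* The bound delta < 1/2 is implicit in the usual formulation: no probability
   measure satisfies mu {v} <= 1 - 2 delta for all v when delta >= 1/2, so
   without it every class of graphs would have the property vacuously. *)
Definition weighted_strong_EH (R : realType) (C : sgraph -> Prop) : Prop :=
  exists delta : R, 0 < delta < 1 / 2 /\
    forall G : sgraph, C G ->
    forall mu : {set G} -> R, probability_measure mu ->
    (forall v : G, mu [set v] <= 1 - 2 * delta) ->
    exists P Q : {set G},
      [/\ homogeneous_pair P Q, delta <= mu P & delta <= mu Q].

(* Main.v *)
(** Take [delta = 1/20].  If some vertex of [G] has mass at least [delta], it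
    forms a homogeneous pair with its neighbours or with its non-neighbours.
    Otherwise write [G = L(H)] and let the degree [d v] of a vertex of [H] be
    the total mass of the edges at [v], so that degrees sum to [2].  The edges
    at a vertex of degree at least [3 delta] form a clique, which is cut into
    two parts of mass at least [delta].  If all degrees are below [3 delta], cut
    the vertices of [H] into four parts of nearly equal total degree and consider
    the three ways of grouping these into two halves.  An edge crosses at most
    two of the three bipartitions, so one of them is crossed by mass at most
    [2/3]; each half then spans mass at least [delta], and the edges inside one
    half are disjoint from the edges inside the other. *)

Require Import Defs.
From HB Require Import structures.
From mathcomp Require Import all_boot all_order all_algebra.
From mathcomp Require Import reals.
From mathcomp Require Import lra.

Set Implicit Arguments.
Unset Strict Implicit.
Unset Printing Implicit Defensive.

Import Order.TTheory GRing.Theory Num.Theory.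
Local Open Scope ring_scope.

(** Take [A] inclusion-minimal among the subsets of [S] of weight at least [t]. Dropping any one
    element brings it below [t], so [A] weighs less than [t + c] and more than [t] remains. *)
Lemma split_weight (R : realFieldType) (T : finType) (f : T -> R) (c t : R)
    (S : {set T}) :
  (forall x, f x <= c) -> 0 <= c -> 0 < t -> 2 * t + c <= \sum_(x in S) f x ->
  exists A : {set T}, [/\ A \subset S, t <= \sum_(x in A) f x
    & t <= \sum_(x in S :\: A) f x].
Proof.
move=> fc c_ge0 t_gt0 leS.
have [|A /minsetP[/andP[AS leA] minA]] :=
    @ex_minset _ [pred A : {set T} | (A \subset S) && (t <= \sum_(x in A) f x)].
  by exists S; rewrite /= subxx; lra.
exists A; split => //.
have [A0|[x xA]] := set_0Vmem A; first by move: leA; rewrite A0 big_set0; lra.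
have ltAx : \sum_(y in A :\ x) f y < t.
  rewrite ltNge; apply/negP => leAx.
  have Ax : A :\ x = A.
    by apply: minA; rewrite /= ?subD1set // (subset_trans (subD1set _ _) AS).
  by move: xA; rewrite -Ax !inE eqxx.
move: leS leA; rewrite (big_setID A) /= (setIidPr AS) (big_setD1 x xA) /=.
by move: (fc x); lra.
Qed.

Lemma ler_sum_disjoint (R : realFieldType) (T : finType) (f : T -> R)
    (A B X : {set T}) :
  (forall x, 0 <= f x) -> [disjoint A & B] -> A :|: B \subset X ->
  \sum_(x in A) f x + \sum_(x in B) f x <= \sum_(x in X) f x.
Proof.
move=> f_ge0 dAB; rewrite subUset => /andP[AX BX].
have BXA : B \subset X :\: A by rewrite subsetD BX disjoint_sym.
rewrite [leRHS](big_setID A) /= (setIidPr AX) lerD2l.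
by rewrite [leRHS](big_setID B) /= (setIidPr BXA) lerDl sumr_ge0.
Qed.

Lemma probability_measure_sum (R : realType) (T : finType) (mu : {set T} -> R) :
  probability_measure mu -> forall A, mu A = \sum_(x in A) mu [set x].
Proof.
move=> [_ _ muU].
have mu0 : mu set0 = 0.
  have := muU set0 set0; rewrite disjoints_subset sub0set setU0 => /(_ isT).
  by lra.
move=> A; have [n] := ubnP #|A|; elim: n A => // n IH A.
have [->|[x xA]] := set_0Vmem A; first by rewrite big_set0.
rewrite (cardsD1 x) xA ltnS => /IH muA.
rewrite (big_setD1 x xA) /= -muA -muU ?setD1K //.
by rewrite disjoints1 !inE eqxx.
Qed.

(** Pulls [ends] back along the isomorphism, so that the vertices of [G] themselves serve as the
    edges. *)
Lemma line_graph_ends (G : sgraph) : is_line_graph G ->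
  exists (V : finType) (ends : G -> {set V}), (forall x, #|ends x| = 2) /\
    forall x y, adj x y = (x != y) && [exists v, (v \in ends x) && (v \in ends y)].
Proof.
move=> [H [f f_bij f_adj]]; exists (mvertex H), (fun x => ends (f x)).
split=> [x|x y]; first exact: card_ends.
by rewrite -f_adj /= /line_adj (inj_eq (bij_inj f_bij)).
Qed.

Section WeightedEdges.

Context (R : realFieldType) (T V : finType) (ends : T -> {set V}) (w : T -> R).
Hypothesis card_ends : forall e, #|ends e| = 2.

Definition degree (v : V) : R := \sum_(e | v \in ends e) w e.

Definition inside (X : {set V}) : {set T} := [set e | ends e \subset X].

Definition crosses (X : {set V}) (e : T) : bool := #|ends e :&: X| == 1.

(** Choosing [u] and [v] before [X] lets several sets be compared on one edge by Boolean case
    analysis. *)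
Lemma card_endsI (e : T) : exists u v, forall X : {set V},
  [/\ #|ends e :&: X| = ((u \in X) + (v \in X))%N,
      (e \in inside X) = (u \in X) && (v \in X)
    & crosses X e = (u \in X) (+) (v \in X)].
Proof.
have /eqP/cards2P[u [v [uv def_e]]] := card_ends e.
exists u, v => X; have cardI : #|ends e :&: X| = ((u \in X) + (v \in X))%N.
  rewrite def_e setIUl cardsU -setIIl.
  have -> : [set u] :&: [set v] = set0.
    by apply/eqP; rewrite setI_eq0 disjoints1 inE.
  rewrite set0I cards0 subn0.
  have card1I z : #|[set z] :&: X| = (z \in X).
    case: (boolP (z \in X)) => zX; first by rewrite (setIidPl _) ?sub1set ?cards1.
    by apply/eqP; rewrite cards_eq0 setI_eq0 disjoints1.
  by rewrite !card1I.
split=> //; last by rewrite /crosses cardI; case: (u \in X); case: (v \in X).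
by rewrite inE def_e subUset !sub1set.
Qed.

(** Double counting: an edge contributes once for each of its ends in [X]. *)
Lemma sum_degree (X : {set V}) :
  \sum_(v in X) degree v =
    2 * \sum_(e in inside X) w e + \sum_(e | crosses X e) w e.
Proof.
rewrite /degree (exchange_big_dep predT) //= mulr_sumr.
rewrite [X in X + _]big_mkcond [X in _ + X]big_mkcond /= -big_split /=.
apply: eq_bigr => e _; rewrite sumr_const.
rewrite (_ : #|_| = #|ends e :&: X|); last first.
  by apply: eq_card => v; rewrite !inE andbC.
have [u [v /(_ X)[-> -> ->]]] := card_endsI e.
by case: (u \in X); case: (v \in X); rewrite /= ?mulr2n ?mulr1n ?mulr0n; lra.
Qed.

Lemma crossesC (X : {set V}) (e : T) : crosses (~: X) e = crosses X e.
Proof.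
have [u [v uvP]] := card_endsI e.
have [_ _ ->] := uvP X; have [_ _ ->] := uvP (~: X).
by rewrite !inE addbN addNb negbK.
Qed.

Hypothesis w_ge0 : forall e, 0 <= w e.
Hypothesis w_sum1 : \sum_e w e = 1.

(** An edge crosses [Z] iff it crosses exactly one of [X] and [Y], so it crosses none or two of the
    three. *)
Lemma sum_crosses3 (X Y Z : {set V}) :
  (forall v, (v \in Z) = (v \in X) (+) (v \in Y)) ->
  \sum_(e | crosses X e) w e + \sum_(e | crosses Y e) w e
    + \sum_(e | crosses Z e) w e <= 2.
Proof.
have -> : 2 = \sum_e 2 * w e by rewrite -mulr_sumr w_sum1 mulr1.
move=> ZP.
rewrite [X in X + _ + _]big_mkcond [X in _ + X + _]big_mkcond.
rewrite [X in _ + X]big_mkcond -!big_split /=.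
apply: ler_sum => e _; move: (w_ge0 e).
have [u [v uvP]] := card_endsI e.
have [_ _ ->] := uvP X; have [_ _ ->] := uvP Y; have [_ _ ->] := uvP Z.
rewrite !ZP; case: (u \in X); case: (v \in X); case: (u \in Y); case: (v \in Y).
all: by rewrite /=; lra.
Qed.

Lemma degree_ge0 v : 0 <= degree v.
Proof. exact: sumr_ge0. Qed.

Lemma sum_degree_setT : \sum_(v in [set: V]) degree v = 2.
Proof.
rewrite sum_degree [X in _ + X]big1 => [|e].
  by rewrite addr0 (eq_bigl predT) ?w_sum1 ?mulr1 // => e; rewrite !inE subsetT.
by rewrite /crosses setIT card_ends.
Qed.

Lemma bipartition_inside :
  (forall v, degree v <= 3 / 20) ->
  exists X : {set V}, 1 / 20 <= \sum_(e in inside X) w e /\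
    1 / 20 <= \sum_(e in inside (~: X)) w e.
Proof.
move=> deg_le.
(* By [sum_degree], each side then has inside mass at least [(31/40 - 2/3) / 2 = 13/240], which
   exceeds [1/20]. *)
suff [X [leX leXC leC]] : exists X : {set V},
    [/\ 31 / 40 <= \sum_(v in X) degree v, 31 / 40 <= \sum_(v in ~: X) degree v
      & \sum_(e | crosses X e) w e <= 2 / 3].
  exists X; move: leX leXC; rewrite !sum_degree.
  by rewrite (eq_bigl _ _ (crossesC X)); lra.
(* The constants are tight for [split_weight]: [2 = 2 * 37/40 + 3/20], then
   [37/40 = 2 * 31/80 + 3/20]. Two quarters together give [31/40]. *)
have [||||S [_ leS leSC]] := @split_weight R V degree (3/20) (37/40) setT;
  rewrite ?sum_degree_setT //; try lra.
rewrite setTD in leSC.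
have [||||A [AS leA leSA]] := @split_weight R V degree (3/20) (31/80) S;
  rewrite //; try lra.
have [||||B [BS leB leSB]] := @split_weight R V degree (3/20) (31/80) (~: S);
  rewrite //; try lra.
have in_parts v : ((v \in A) ==> (v \in S)) && ((v \in B) ==> (v \notin S)).
  apply/andP; split; apply/implyP; first exact: (subsetP AS).
  by move/(subsetP BS); rewrite inE.
(* Disjointness and inclusion are stated pointwise, so that each use reduces to cases on membership
   in [A], [B] and [S]. *)
have le_halves (P Q X : {set V}) :
    31 / 80 <= \sum_(v in P) degree v -> 31 / 80 <= \sum_(v in Q) degree v ->
    (forall v, ~~ ((v \in P) && (v \in Q)) &&
      ((v \in P) || (v \in Q) ==> (v \in X))) ->
    31 / 40 <= \sum_(v in X) degree v.
  move=> leP leQ PQX.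
  have dPQ : [disjoint P & Q].
    rewrite disjoints_subset; apply/subsetP => v; have := PQX v.
    by rewrite inE; case: (v \in P) => //= /andP[].
  have subX : P :|: Q \subset X.
    by apply/subsetP => v; rewrite inE => PQv; have /andP[_] := PQX v; rewrite PQv.
  by have := ler_sum_disjoint degree_ge0 dPQ subX; lra.
(* With [S], these are the three pairings of the quarters [A], [S :\: A], [B] and [~: S :\: B]. *)
pose Y := A :|: B; pose Z := (S :\: A) :|: B.
have ZP v : (v \in Z) = (v \in S) (+) (v \in Y).
  move: (in_parts v); rewrite !inE.
  by case: (v \in A); case: (v \in B); case: (v \in S).
have cross3 := sum_crosses3 ZP.
have [|ltS] := lerP (\sum_(e | crosses S e) w e) (2 / 3).
  by exists S; split=> //; lra.
have [leY|ltY] := lerP (\sum_(e | crosses Y e) w e) (2 / 3).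
  exists Y; split=> //.
  - apply: (le_halves A B) => // v; move: (in_parts v); rewrite !inE.
    by case: (v \in A); case: (v \in B); case: (v \in S).
  - apply: (le_halves (S :\: A) (~: S :\: B)) => // v; move: (in_parts v).
    rewrite !inE.
    by case: (v \in A); case: (v \in B); case: (v \in S).
exists Z; split; last by lra.
- apply: (le_halves (S :\: A) B) => // v; move: (in_parts v); rewrite !inE.
  by case: (v \in A); case: (v \in B); case: (v \in S).
- apply: (le_halves A (~: S :\: B)) => // v; move: (in_parts v); rewrite !inE.
  by case: (v \in A); case: (v \in B); case: (v \in S).
Qed.

End WeightedEdges.

(** The vertices other than [x] weigh at least [2 * d], so the neighbours or the non-neighbours of
    [x] weigh at least [d]. *)
Lemma heavy_vertex_homogeneous_pair (R : realFieldType) (G : sgraph)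
    (w : G -> R) (d : R) (x : G) :
  0 < d -> \sum_y w y = 1 -> d <= w x -> w x <= 1 - 2 * d ->
  exists P Q : {set G}, [/\ homogeneous_pair P Q,
    d <= \sum_(y in P) w y & d <= \sum_(y in Q) w y].
Proof.
move=> d_gt0 w1 lewx wx_le.
pose N := [set y | adj x y]; pose M := ~: N :\ x.
have sumE : w x + \sum_(y in N) w y + \sum_(y in M) w y = 1.
  have xN : x \in ~: N by rewrite !inE adj_irrefl.
  rewrite -w1 -(eq_bigl _ _ (in_setT (T := G))) [RHS](big_setID N) /= setTI setTD.
  by rewrite (big_setD1 x xN) /= -/M; lra.
have [leN|ltN] := lerP d (\sum_(y in N) w y).
  exists [set x], N; split; rewrite ?big_set1 //; split.
    by rewrite disjoints1 inE adj_irrefl.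
  by left=> y z; rewrite !inE => /eqP->.
exists [set x], M; split; rewrite ?big_set1 //; last by lra.
split; first by rewrite disjoints1 !inE eqxx.
by right=> y z; rewrite !inE => /eqP-> /andP[].
Qed.

Theorem theorem3p2 (R : realType) : weighted_strong_EH R is_line_graph.
Proof.
exists (1 / 20); split; first lra.
move=> G /line_graph_ends[V [ends [card_ends adjE]]] mu mu_prob mu_le.
have muE := probability_measure_sum mu_prob.
have [mu_ge0 mu1 _] := mu_prob.
pose w x := mu [set x].
have w_sum1 : \sum_x w x = 1.
  by rewrite -mu1 muE; apply: eq_bigl => x; rewrite inE.
suff [P [Q [PQ leP leQ]]] : exists P Q : {set G}, [/\ homogeneous_pair P Q,
    1 / 20 <= \sum_(x in P) w x & 1 / 20 <= \sum_(x in Q) w x].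
  by exists P, Q; rewrite !muE.
case: (pickP (fun x => 1 / 20 <= w x)) => [x lewx|w_lt].
  by apply: (heavy_vertex_homogeneous_pair (x := x)) => //; [lra|exact: mu_le].
have w_le x : w x <= 1 / 20 by apply/ltW; rewrite ltNge w_lt.
case: (pickP (fun v => 3 / 20 <= degree ends w v)) => [v ledv|deg_lt].
  have leS : 2 * (1 / 20) + 1 / 20 <= \sum_(x in [set x | v \in ends x]) w x.
    have -> : \sum_(x in [set x | v \in ends x]) w x = degree ends w v.
      by apply: eq_bigl => x; rewrite inE.
    by lra.
  have d_gt0 : 0 < 1 / 20 :> R by lra.
  have [A [AS leA leSA]] := split_weight w_le (ltW d_gt0) d_gt0 leS.
  exists A, ([set x | v \in ends x] :\: A); split=> //; split.
    by rewrite disjoints_subset; apply/subsetP => x xA; rewrite !inE xA.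
  left=> x y xA; rewrite !inE => /andP[yA vy]; rewrite adjE.
  move/subsetP/(_ x xA): AS; rewrite inE => vx.
  apply/andP; split; last by apply/existsP; exists v; rewrite vx.
  by apply: contraNneq yA => <-.
have [|X [leX leXC]] :=
  bipartition_inside card_ends (fun x => mu_ge0 [set x]) w_sum1.
  by move=> v; apply/ltW; rewrite ltNge deg_lt.
have inside_disjoint x y v : x \in inside ends X -> y \in inside ends (~: X) ->
    v \in ends x -> v \notin ends y.
  rewrite !inE => /subsetP xX /subsetP yX /xX vX.
  by apply/negP => /yX; rewrite inE vX.
exists (inside ends X), (inside ends (~: X)); split=> //; split.
  (* An edge inside both halves would have no end at all, but it has two. *)
  rewrite disjoints_subset; apply/subsetP => x xX; rewrite inE; apply/negP => xXC.
  have [v vx] : exists v, v \in ends x by apply/card_gt0P; rewrite card_ends.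
  by have := inside_disjoint _ _ _ xX xXC vx; rewrite vx.
right=> x y xX yX; rewrite adjE negb_and; apply/orP; right.
rewrite negb_exists; apply/forallP => v; rewrite negb_and -implybE.
by apply/implyP; apply: inside_disjoint.
Qed.
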